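(* Let $k \geqslant 3$ be an integer. For all integers $n \geqslant 2$ and $m \geqslant 1$ with $(m,n)=1$, $$\left| S_k(n,m) - 2^{-k} n^k \varphi(n)^{k-1} \right| \leqslant (2\sqrt{3})^k \, n^{3k/2} (\log n)^k .$$
   Context: $(a,b)$ denotes the greatest common divisor, $\varphi$ is Euler's totient function, and $\log$ is the natural logarithm. For integers $k \geqslant 2$, $n \geqslant 2$, $m \geqslant 1$ with $(m,n)=1$, $$S_k(n,m) := \sum_{\substack{1 \leqslant a_1,\dots,a_k \leqslant n \\ a_1 \cdots a_k \equiv m \ (\mathrm{mod}\ n)}} a_1 \cdots a_k ,$$ with the convention that only tuples with $(a_j,n)=1$ for all $j$ contribute (this is automatic because $(m,n)=1$). *)

(* Defs.v *)
From mathcomp Require Import all_boot.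

Set Implicit Arguments.
Unset Strict Implicit.
Unset Printing Implicit Defensive.

(* The tuple entries live in 'I_n.+1 = {0, ..., n}, so that together with
   1 <= a j they range over {1, ..., n}.  The condition coprime (a j) n is
   redundant when coprime m n. *)
Definition Sk (k n m : nat) : nat :=
  \sum_(a : {ffun 'I_k -> 'I_n.+1} |
        [forall j, (1 <= a j) && coprime (a j) n] &&
        (\prod_j a j == m %[mod n]))
    \prod_j a j.

Lemma Sk_coprimeE (k n m : nat) : coprime m n ->
  Sk k n m = \sum_(a : {ffun 'I_k -> 'I_n.+1} |
        [forall j, 1 <= a j] && (\prod_j a j == m %[mod n]))
    \prod_j a j.
Proof.
move=> comn; apply: eq_bigl => a.
case: (boolP (_ == _ %[mod n])) => [/eqP Ea|]; last by rewrite !andbF.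
have coP : coprime (\prod_j a j) n by rewrite -coprime_modl Ea coprime_modl.
rewrite !andbT; apply: eq_forallb => j.
suff -> : coprime (a j) n by rewrite andbT.
by move: coP; rewrite (bigD1 j) //= coprimeMl => /andP[].
Qed.

(* Main.v *)
Require Import Defs.
From mathcomp Require Import all_boot all_order all_algebra.
From mathcomp Require Import all_classical all_reals all_analysis.
From mathcomp Require Import cyclic.
From mathcomp Require Import ring lra zify.
Import Order.TTheory GRing.Theory Num.Theory.
Import numFieldNormedType.Exports.
Set Implicit Arguments.
Unset Strict Implicit.
Unset Printing Implicit Defensive.
Local Open Scope ring_scope.

(** Every sum over residues below runs over the reduced residues mod [n].  For a
weight [f], let [T_f psi] be the function [x |-> sum over a of f a * psi (a x)].
The k-th power of [T_f] with [f a = a], applied to the indicator of the class of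
[m] and evaluated at 1, is [Sk k n m].  Write [a = n/2 + saw n a], where [saw] is
the centred sawtooth; it sums to zero over the reduced residues.  Hence the
constant part and the sawtooth part do not interact
([iter_conv_split_mean]): the constant part contributes exactly
[(n/2)^k phi(n)^(k-1)], and the error is the value at 1 of the k-th power of
[T_saw] on a function of l2 norm 1.  It is therefore at most the k-th power of
the l2 operator norm of [T_saw], and the theorem reduces to
[norm^2 <= 12 n^3 (ln n)^2].

The functions [x |-> chi x] for the Dirichlet characters mod [n] diagonalize
[T_saw], and the eigenvalues are the sums [sum of a chi(a)], so the norm bound is
a form of the Polya-Vinogradov inequality.  The proof here stays with real
functions and replaces the conductor of a character by an orthogonal
decomposition.

For a prime [p] dividing [n], with [d = n/p], average a function over the
multiplications by residues congruent to 1 mod [d].  This is an orthogonal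
projection that commutes with [T_saw], and the projections for different primes
commute with one another.  So the norm of [T_saw] is the largest of its norms on
the range of each projection and on the intersection of their kernels
([conv_bound_split]).

On the range of the projection for [p], functions come from functions mod [d], and
the distribution relation of the sawtooth turns [T_saw] mod [n] into [p] times the
operator mod [d], or into [p] times a difference of two translates of it when [p]
does not divide [d] ([conv_descent]).  The squared norm gains a factor
[p^2] or [4 p^2], whereas [n^3] loses [p^3]; only [p = 2] and [p = 3] can lose
anything, once each, which [norm_bound] records ([norm_bound_descent]).

On the intersection of the kernels, the role of primitive characters, expand the
sawtooth in sines, [saw n x = sum over h of c_h sin(2 pi h x / n)] with
[c_h = - cot(pi h / n) / 2] ([saw_fourier]).  The frequencies [h] that share a
prime with [n] act as zero, and each coprime frequency acts with norm at most
[sqrt n] by the orthogonality relations ([sin_mod_bound]).  Since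
[|c_h| <= (n/4) (1/h + 1/(n-h))], the norm is at most
[sqrt n * (n/2) * (1 + 1/2 + ... + 1/(n-1)) = O(n^(3/2) ln n)]
([primitive_bound], [saw_coef_sum]). *)

(** * Sums over reduced residues *)

Section ReducedResidues.
Variable R : nmodType.
Implicit Types (n d k : nat) (f g : nat -> R).

Definition periodic_mod n f := forall x, f (x %% n)%N = f x.

Lemma eq_periodic_mod n f x y : periodic_mod n f -> x = y %[mod n] -> f x = f y.
Proof. by move=> pf e; rewrite -pf e pf. Qed.

Lemma eqmod_mul2l n k x y : coprime k n ->
  (k * x == k * y %[mod n])%N = (x == y %[mod n])%N.
Proof.
move=> kn; wlog le_xy : x y / (x <= y)%N.
  by move=> H; case/orP: (leq_total x y) => /H // e; rewrite eq_sym e eq_sym.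
rewrite eq_sym [RHS]eq_sym !eqn_mod_dvd ?leq_mul2l ?le_xy ?orbT //.
by rewrite -mulnBr Gauss_dvdr // coprime_sym.
Qed.

Lemma sum_coprime_mul n k f : periodic_mod n f -> coprime k n ->
  \sum_(y < n | coprime y n) f (k * y)%N = \sum_(y < n | coprime y n) f y.
Proof.
case: n => [|n] pf kn; first by rewrite !big_ord0.
pose h (y : 'I_n.+1) : 'I_n.+1 := Ordinal (ltn_pmod (k * y) (ltn0Sn n)).
have hI : injective h.
  move=> x y /(congr1 val) /= /eqP; rewrite eqmod_mul2l // => /eqP.
  by rewrite !modn_small // => /val_inj.
rewrite [RHS](reindex_inj hI) /=; apply: eq_big => [y|y _]; last by rewrite pf.
by rewrite coprime_modl coprimeMl kn.
Qed.

(** Euler's theorem makes this power an inverse of [x] mod [n] when [x] is coprime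
to [n]. *)
Definition inv_mod n x := (x ^ (totient n).-1)%N.

Lemma inv_modP n x : (0 < n)%N -> coprime x n -> x * inv_mod n x = 1 %[mod n].
Proof.
move=> n0 xn; rewrite -expnS prednK ?totient_gt0 //.
exact: Euler_exp_totient.
Qed.

Lemma coprime_inv_mod n x : coprime x n -> coprime (inv_mod n x) n.
Proof. by move=> xn; rewrite coprimeXl. Qed.

(** Inversion is an involution of the reduced residues. *)
Lemma sum_coprime_inv n f : periodic_mod n f ->
  \sum_(y < n | coprime y n) f (inv_mod n y) = \sum_(y < n | coprime y n) f y.
Proof.
case: n => [|n] pf; first by rewrite !big_ord0.
pose h (y : 'I_n.+1) : 'I_n.+1 := Ordinal (ltn_pmod (inv_mod n.+1 y) (ltn0Sn n)).
have hh (y : 'I_n.+1) : coprime y n.+1 -> h (h y) = y.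
  move=> yn; apply: val_inj => /=; rewrite /inv_mod modnXm -/(inv_mod _ _).
  have e1 := inv_modP (ltn0Sn n) yn.
  have e2 := inv_modP (ltn0Sn n) (coprime_inv_mod yn).
  rewrite -[RHS](modn_small (ltn_ord y)).
  apply/eqP; rewrite -(@eqmod_mul2l _ (inv_mod n.+1 y)) ?coprime_inv_mod //.
  by rewrite e2 mulnC e1.
rewrite [RHS](reindex_onto h h hh) /=; apply: eq_big => [y|y _]; last by rewrite pf.
rewrite coprime_modl; apply/idP/andP => [yn|[hy /eqP e]].
  by rewrite coprime_inv_mod // hh.
by rewrite -e /= coprime_modl coprime_inv_mod //= coprime_modl.
Qed.
End ReducedResidues.

(** * Multiplicative convolution and averaging operators *)

Section Convolution.
Variable R : realFieldType.
Implicit Types (n d k : nat) (f g u v w psi : nat -> R).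

Definition conv n f psi (x : nat) : R :=
  \sum_(a < n | coprime a n) f a * psi (a * x)%N.

Definition sqnorm n psi : R := \sum_(x < n | coprime x n) psi x ^+ 2.

Lemma sqnorm_ge0 n psi : 0 <= sqnorm n psi.
Proof. by apply: sumr_ge0 => x _; rewrite sqr_ge0. Qed.

Lemma conv_periodic n d f psi : periodic_mod d psi -> periodic_mod d (conv n f psi).
Proof.
move=> pp x; apply: eq_bigr => a _; congr (_ * _).
by apply: (eq_periodic_mod pp); rewrite modnMmr.
Qed.

Lemma convD n f psi phi x :
  conv n f (fun y => psi y + phi y) x = conv n f psi x + conv n f phi x.
Proof. by rewrite -big_split; apply: eq_bigr => a _; rewrite /= mulrDr. Qed.

(** For [d] dividing [n], the residues [k] with [in_kernel d k = 1] form the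
kernel of the reduction from the units mod [n] to the units mod [d]. *)
Definition in_kernel d k : R := (k == 1 %[mod d])%:R.

(** Up to the factor given by the order of the kernel, this is the orthogonal
projection onto [kernel_inv n d]. *)
Definition kernel_sum n d psi x : R :=
  \sum_(k < n | coprime k n) in_kernel d k * psi (k * x)%N.

Definition kernel_inv n d psi :=
  forall k x, coprime k n -> k = 1 %[mod d] -> psi (k * x)%N = psi x.

Lemma in_kernel_periodic n d : (d %| n)%N -> periodic_mod n (in_kernel d).
Proof. by move=> dn k; rewrite /in_kernel modn_dvdm. Qed.

Lemma periodic_modM n f g : periodic_mod n f -> periodic_mod n g ->
  periodic_mod n (fun x => f x * g x).
Proof. by move=> pf pg x; rewrite pf pg. Qed.

Lemma kernel_sum_periodic n d e psi :
  periodic_mod e psi -> periodic_mod e (kernel_sum n d psi).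
Proof.
move=> pp x; apply: eq_bigr => a _; congr (_ * _).
by apply: (eq_periodic_mod pp); rewrite modnMmr.
Qed.

Lemma kernel_sum_inv n d psi : (d %| n)%N -> periodic_mod n psi ->
  kernel_inv n d (kernel_sum n d psi).
Proof.
move=> dn pp k x kn k1.
pose F l := in_kernel d l * psi (l * x)%N.
have pF : periodic_mod n F.
  apply: periodic_modM; first exact: in_kernel_periodic.
  by move=> l; apply: (eq_periodic_mod pp); rewrite modnMml.
rewrite -[RHS](@sum_coprime_mul R n k F) //; apply: eq_bigr => l _.
rewrite /F /in_kernel mulnA [(l * k)%N]mulnC; congr ((_ == _)%:R * _).
by rewrite -modnMml k1 modnMml mul1n.
Qed.

Lemma kernel_sum_of_inv n d psi x : kernel_inv n d psi ->
  kernel_sum n d psi x = (\sum_(k < n | coprime k n) in_kernel d k) * psi x.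
Proof.
move=> pi; rewrite mulr_suml; apply: eq_bigr => k kn; rewrite /in_kernel.
by case: eqP => [k1|_]; [rewrite pi | rewrite !mul0r].
Qed.

Lemma in_kernel_sum_gt0 n d : (0 < n)%N -> (d %| n)%N ->
  0 < \sum_(k < n | coprime k n) in_kernel d k.
Proof.
case: n => // n _ dn; pose o : 'I_n.+1 := Ordinal (ltn_pmod 1 (ltn0Sn n)).
have on : coprime o n.+1 by rewrite coprime_modl coprime1n.
rewrite (bigD1 o on) /= /in_kernel modn_dvdm // eqxx ltr_pwDl ?ltr01 //.
by apply: sumr_ge0 => k _; rewrite ler0n.
Qed.

(** Summing [v * w] over a coset of the kernel gives a value of [v] times a
[kernel_sum] of [w], which vanishes. *)
Lemma kernel_inv_orth n d v w : (0 < n)%N -> (d %| n)%N ->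
  periodic_mod n v -> periodic_mod n w -> kernel_inv n d v ->
  (forall x, kernel_sum n d w x = 0) ->
  \sum_(x < n | coprime x n) v x * w x = 0.
Proof.
move=> n0 dn pv pw vi w0.
have /lt0r_neq0 /mulfI := in_kernel_sum_gt0 n0 dn; apply; rewrite mulr0.
transitivity (\sum_(x < n | coprime x n) v x * kernel_sum n d w x); last first.
  by apply: big1 => x _; rewrite w0 mulr0.
rewrite mulr_suml.
under [RHS]eq_bigr => x _ do rewrite mulr_sumr.
rewrite exchange_big /=; apply: eq_bigr => k kn.
rewrite -(@sum_coprime_mul R n k (fun x => v x * w x)) ?mulr_sumr //;
  last exact: periodic_modM.
apply: eq_bigr => x _; rewrite /in_kernel; case: eqP => [k1|_]; last by rewrite !mul0r mulr0.
by rewrite vi // !mul1r.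
Qed.

Lemma conv_kernel_inv n d f psi : kernel_inv n d psi -> kernel_inv n d (conv n f psi).
Proof.
by move=> pi k x kn k1; apply: eq_bigr => a _; rewrite mulnCA pi.
Qed.

(** Both sides are double sums of [psi (k a x)]: multiplications commute.  This is
why the averaging projections commute with every convolution operator. *)
Lemma kernel_sum_conv n d f psi x :
  kernel_sum n d (conv n f psi) x = conv n f (kernel_sum n d psi) x.
Proof.
rewrite /kernel_sum /conv; under eq_bigr => k _ do rewrite mulr_sumr.
rewrite exchange_big /=; apply: eq_bigr => a _.
rewrite mulr_sumr; apply: eq_bigr => k _.
by rewrite mulrCA mulnCA.
Qed.

(** A [kernel_sum] is itself a convolution, with weight [in_kernel]. *)
Lemma kernel_sumC n d e psi x :
  kernel_sum n d (kernel_sum n e psi) x = kernel_sum n e (kernel_sum n d psi) x.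
Proof. exact: (kernel_sum_conv n d (in_kernel e)). Qed.

Lemma sqnorm_orth n d v w : (0 < n)%N -> (d %| n)%N ->
  periodic_mod n v -> periodic_mod n w -> kernel_inv n d v ->
  (forall x, kernel_sum n d w x = 0) ->
  sqnorm n (fun x => v x + w x) = sqnorm n v + sqnorm n w.
Proof.
move=> n0 dn pv pw vi w0; rewrite /sqnorm.
under eq_bigr => x _ do rewrite sqrrD.
by rewrite 2!big_split /= sumrMnl (kernel_inv_orth n0 dn pv pw vi w0) mul0rn addr0.
Qed.

(** One divisor at a time, split the function into its average over the kernel and
the remainder.  The two parts are orthogonal, as are their images, so a common
bound for both carries over to the sum.  The remainder keeps the vanishing sums
already obtained because [kernel_sum]s commute. *)
Lemma conv_bound_split n f (C : R) (s : seq nat) : (0 < n)%N ->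
  (forall d, d \in s -> (d %| n)%N) ->
  (forall d v, d \in s -> periodic_mod n v -> kernel_inv n d v ->
     sqnorm n (conv n f v) <= C * sqnorm n v) ->
  (forall w, periodic_mod n w -> (forall d x, d \in s -> kernel_sum n d w x = 0) ->
     sqnorm n (conv n f w) <= C * sqnorm n w) ->
  forall u, periodic_mod n u -> sqnorm n (conv n f u) <= C * sqnorm n u.
Proof.
move=> n0; elim: s => [|d s IH] s_dvd Hv Hw; first by move=> u pu; apply: Hw.
apply: IH => [e es|e v es|u pu us]; first by apply: s_dvd; rewrite inE es orbT.
  by apply: Hv; rewrite inE es orbT.
have dn : (d %| n)%N by apply: s_dvd; rewrite inE eqxx.
set F := \sum_(k < n | coprime k n) in_kernel d k.
have F0 : F != 0 by apply: lt0r_neq0; apply: in_kernel_sum_gt0.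
pose v x := F^-1 * kernel_sum n d u x; pose w x := u x - v x.
have pv : periodic_mod n v by move=> x; rewrite /v (kernel_sum_periodic n d pu).
have pw : periodic_mod n w by move=> x; rewrite /w pu pv.
have vi : kernel_inv n d v by move=> k x kn k1; rewrite /v kernel_sum_inv.
have kernel_sumB e x : kernel_sum n e w x = kernel_sum n e u x - kernel_sum n e v x.
  rewrite /kernel_sum -sumrB; apply: eq_bigr => k _; by rewrite /w mulrBr.
have w0 x : kernel_sum n d w x = 0.
  by rewrite kernel_sumB (kernel_sum_of_inv _ vi) -/F /v mulVKf // subrr.
have ws e x : e \in s -> kernel_sum n e w x = 0.
  move=> es; rewrite kernel_sumB us //.
  have -> : kernel_sum n e v x = F^-1 * kernel_sum n e (kernel_sum n d u) x.
    by rewrite {1}/kernel_sum mulr_sumr; apply: eq_bigr => k _; rewrite mulrCA.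
  rewrite kernel_sumC [X in _ * X]big1 ?mulr0 ?subr0 // => k _.
  by rewrite us // mulr0.
have uE x : u x = v x + w x by rewrite /w addrC subrK.
have sE g h : (forall x, g x = h x) -> sqnorm n g = sqnorm n h.
  by move=> gh; apply: eq_bigr => x _; rewrite gh.
rewrite (sE _ _ uE) (@sqnorm_orth n d) //.
rewrite (sE _ (fun x => conv n f v x + conv n f w x)); last first.
  by move=> x; rewrite -convD; apply: eq_bigr => a _; rewrite uE.
rewrite (@sqnorm_orth n d) //; first last.
- by move=> x; rewrite kernel_sum_conv; apply: big1 => a _; rewrite w0 mulr0.
- exact: conv_kernel_inv.
- exact: conv_periodic.
- exact: conv_periodic.
rewrite mulrDr lerD //; first by apply: (Hv d); rewrite ?inE ?eqxx.
by apply: Hw => // e x; rewrite inE => /orP[/eqP->|] //; apply: ws.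
Qed.
End Convolution.

(** * Descent of the sawtooth to a divisor *)

Section Descent.
Variable R : realFieldType.
Implicit Types (n d p k : nat) (f g u v w psi : nat -> R).

(** [n] times the sawtooth function at [z / n].  The value 0 at multiples of [n]
makes it odd, and makes the distribution relation hold at every point. *)
Definition saw n z : R := if (n %| z)%N then 0 else (z %% n)%:R - n%:R / 2.

Lemma sawE n z : (0 < n)%N ->
  saw n z = (z %% n)%:R - n%:R / 2 + (n %| z)%:R * (n%:R / 2).
Proof.
rewrite /saw /dvdn; case: eqP => [->|_] n0; last by rewrite mul0r addr0.
by rewrite mul1r subrK.
Qed.

Lemma saw_periodic n : periodic_mod n (saw n).
Proof. by move=> z; rewrite /saw /dvdn modn_mod. Qed.

Lemma saw_opp n y : (0 < n)%N -> saw n (n.-1 * y) = - saw n y.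
Proof.
move=> n0; rewrite /saw Gauss_dvdr; last by rewrite coprime_sym coprimePn.
case: ifPn => [|ny]; first by rewrite oppr0.
have r0 : (0 < y %% n)%N by rewrite lt0n.
have rn : (y %% n < n)%N by rewrite ltn_mod.
suff -> : (n.-1 * y %% n = n - y %% n)%N by rewrite natrB ?(ltnW rn) //; lra.
rewrite -[RHS](@modn_small _ n); last by lia.
apply/eqP; rewrite -(eqn_modDr (y %% n)) subnK ?(ltnW rn) // modnDmr.
by rewrite -mulSnr prednK // modnMr modnn.
Qed.

Lemma saw_sum0 n : \sum_(a < n | coprime a n) saw n a = 0.
Proof.
case: n => [|n]; first by rewrite big_ord0.
have := @sum_coprime_mul R n.+1 n (saw n.+1) (saw_periodic _) (coprimenS _).
under eq_bigr => a _ do rewrite (saw_opp _ (ltn0Sn n)).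
by rewrite sumrN => /eqP; rewrite eqr_oppLR -subr_eq0 opprK -mulr2n mulrn_eq0 /= => /eqP.
Qed.

Lemma saw_scale p d (w : nat) : (0 < p)%N -> saw (p * d) (p * w) = p%:R * saw d w.
Proof.
move=> p0; rewrite /saw dvdn_pmul2l // -muln_modr !natrM.
by case: ifP => _; [rewrite mulr0 | field].
Qed.

Lemma sum_residue p d c f : (0 < d)%N ->
  \sum_(z < p * d) (z == c %[mod d])%:R * f z = \sum_(j < p) f (c %% d + j * d)%N.
Proof.
move=> d0; elim: p => [|p IH]; first by rewrite !big_ord0.
rewrite mulSnr big_split_ord /= IH big_ord_recr /=; congr (_ + _).
pose o : 'I_d := Ordinal (ltn_pmod c d0).
rewrite (bigD1 o) //= big1 ?addr0 => [|i io].
  by rewrite modnMDl modn_mod eqxx mul1r addnC.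
rewrite modnMDl modn_small //; case: eqP => [e|_]; last by rewrite mul0r.
by case/eqP: io; apply: val_inj.
Qed.

Lemma sum_ord p : \sum_(j < p) (j%:R : R) = p%:R * (p%:R - 1) / 2.
Proof.
elim: p => [|p IH]; first by rewrite big_ord0 !mul0r.
by rewrite big_ord_recr /= IH -natr1; field.
Qed.

(** The distribution relation of the sawtooth, the reason for the normalization
chosen in [saw]. *)
Lemma saw_distr p d c : (0 < p)%N -> (0 < d)%N ->
  \sum_(j < p) saw (p * d) (c %% d + j * d) = p%:R * saw d c.
Proof.
move=> p0 d0; have r_lt := ltn_pmod c d0.
have jE (j : 'I_p) : saw (p * d) (c %% d + j * d) =
    (c %% d)%:R + j%:R * d%:R - (p * d)%:R / 2
    + ((j == 0 :> nat) && (d %| c))%N%:R * ((p * d)%:R / 2).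
  have lt : (c %% d + j * d < p * d)%N.
    by have := ltn_ord j; nia.
  rewrite sawE ?muln_gt0 ?p0 // modn_small // natrD natrM; congr (_ + _%:R * _).
  rewrite /dvdn modn_small // addn_eq0 muln_eq0 andbC.
  by rewrite (gtn_eqF d0) orbF.
under eq_bigr => j _ do rewrite jE.
rewrite !big_split /= !sumr_const card_ord -[(c %% d)%:R *+ p]mulr_natr.
rewrite -[_ *+ p in X in _ + X + _]mulr_natr.
rewrite -!mulr_suml sum_ord sawE //.
have -> : \sum_(j < p) ((j == 0 :> nat) && (d %| c))%N%:R = (d %| c)%:R :> R.
  by case: (p) p0 => // q _; rewrite big_ord_recl big1 ?addr0.
by rewrite natrM; field.
Qed.

(** The lifts of [c] to residues mod [p d] are [c + j d]; when [p] divides [d]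
they are all coprime to [p d], otherwise exactly one of them, [p] times the class
of [c / p] mod [d], is not. *)
Lemma fiber_sum p d c f : prime p -> (0 < d)%N -> coprime c d ->
  \sum_(z < p * d | coprime z (p * d)) (z == c %[mod d])%:R * f z
  = \sum_(j < p) f (c %% d + j * d)%N
    - (~~ (p %| d)%N)%:R * f (p * ((inv_mod d p * c) %% d))%N.
Proof.
move=> pp d0 cd; have p0 := prime_gt0 pp.
have cz z : z = c %[mod d] -> coprime z d by move=> e; rewrite -coprime_modl e coprime_modl.
rewrite -(sum_residue _ _ _ d0) big_mkcond /=.
case: (boolP (p %| d)%N) => pd.
  rewrite mul0r subr0; apply: eq_bigr => z _.
  case: eqP => [e|]; last by rewrite mul0r if_same.
  have zd := cz _ e; rewrite coprimeMr zd andbT.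
  by rewrite (coprime_dvdr pd zd).
have cpd : coprime p d by rewrite prime_coprime.
have inj (w : nat) : (w < d)%N -> (p * w == c %[mod d])%N = (w == (inv_mod d p * c) %% d)%N.
  move=> wd; rewrite -[w in RHS](modn_small wd).
  rewrite -[RHS](eqmod_mul2l _ _ cpd) mulnA -(modnMml (p * inv_mod d p) c).
  by rewrite (inv_modP d0 cpd) modnMml mul1n.
rewrite mul1r.
have -> : f (p * ((inv_mod d p * c) %% d))%N =
    \sum_(z < p * d) (p %| z)%N%:R * ((z == c %[mod d])%:R * f z).
  have := sum_residue d 0 (fun z => (z == c %[mod d])%:R * f z) p0.
  rewrite mulnC mod0n => e.
  transitivity (\sum_(j < d) (0 + j * p == c %[mod d])%:R * f (0 + j * p)%N); last first.
    by rewrite -e; apply: eq_bigr => z _.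
  rewrite (bigD1 (Ordinal (ltn_pmod (inv_mod d p * c) d0))) //= big1 ?addr0 => [|j ji].
    by rewrite add0n [(_ * p)%N]mulnC inj ?ltn_pmod // eqxx mul1r.
  rewrite add0n [(_ * p)%N]mulnC inj //; case: eqP => [e'|_]; last by rewrite mul0r.
  by case/eqP: ji; apply: val_inj.
rewrite -sumrB; apply: eq_bigr => z _.
case: eqP => [e|]; last by rewrite !mul0r mulr0 subr0 if_same.
rewrite coprimeMr (cz _ e) andbT coprime_sym prime_coprime //.
by case: (p %| z)%N; rewrite /= !mul1r ?subrr // mul0r subr0.
Qed.

Lemma sum_fibers n d f g : (0 < d)%N -> (d %| n)%N -> periodic_mod d g ->
  \sum_(y < n | coprime y n) f y * g y =
  \sum_(b < d | coprime b d) g b * \sum_(y < n | coprime y n) (y == b %[mod d])%:R * f y.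
Proof.
move=> d0 dn pg; under [RHS]eq_bigr => b _ do rewrite mulr_sumr.
rewrite exchange_big /=; apply: eq_bigr => y yn.
have yd : coprime (y %% d) d by rewrite coprime_modl (coprime_dvdr dn).
rewrite (bigD1 (Ordinal (ltn_pmod y d0))) //= big1 ?addr0 => [|b /andP[_ ji]].
  by rewrite pg modn_mod eqxx mul1r mulrC.
rewrite (modn_small (ltn_ord b)); case: eqP => [e'|_]; last by rewrite mul0r mulr0.
by case/eqP: ji; apply: val_inj.
Qed.

Lemma fiber_card p d c : prime p -> (0 < d)%N -> coprime c d ->
  \sum_(z < p * d | coprime z (p * d)) ((z == c %[mod d])%:R : R) =
  p%:R - (~~ (p %| d)%N)%:R.
Proof.
move=> pp d0 cd.
under eq_bigr => z _ do rewrite -[(_ == _)%:R]mulr1.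
by rewrite (@fiber_sum _ _ _ (fun=> 1)) // sumr_const card_ord mulr1.
Qed.

Lemma saw_fiber p d c : prime p -> (0 < d)%N -> coprime c d ->
  \sum_(z < p * d | coprime z (p * d)) (z == c %[mod d])%:R * saw (p * d) z
  = p%:R * (saw d c - (~~ (p %| d)%N)%:R * saw d (inv_mod d p * c)).
Proof.
move=> pp d0 cd; have p0 := prime_gt0 pp.
rewrite fiber_sum // saw_distr // saw_scale // saw_periodic.
by rewrite mulrBr mulrCA.
Qed.

(** A kernel-invariant [v] agrees on reduced residues with a function [w] mod [d].
By [saw_fiber] its convolution is [p (h x - h (p x))], or [p (h x)] when [p]
divides [d], where [h] is the convolution of [w] mod [d].  The factor 4 is the
cost of [(a - b)^2 <= 2 a^2 + 2 b^2]. *)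
Lemma conv_descent p d (C : R) : prime p -> (0 < d)%N ->
  (forall w, periodic_mod d w -> sqnorm d (conv d (saw d) w) <= C * sqnorm d w) ->
  forall v, periodic_mod (p * d) v -> kernel_inv (p * d) d v ->
  sqnorm (p * d) (conv (p * d) (saw (p * d)) v)
    <= (if (p %| d)%N then 1 else 4) * p%:R ^+ 2 * C * sqnorm (p * d) v.
Proof.
move=> pp d0 HC v pv vi; have p0 := prime_gt0 pp; set n := (p * d)%N.
have n0 : (0 < n)%N by rewrite muln_gt0 p0.
have dn : (d %| n)%N by rewrite dvdn_mull.
set F : R := p%:R - (~~ (p %| d)%N)%:R.
have F0 : 0 < F.
  by rewrite subr_gt0 ltr_nat; case: (p %| d)%N => //; rewrite prime_gt1.
pose w b := F^-1 * \sum_(z < n | coprime z n) (z == b %[mod d])%:R * v z.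
have pw : periodic_mod d w.
  by move=> b; congr (_ * _); apply: eq_bigr => z _; rewrite modn_mod.
have wE x : coprime x n -> v x = w x.
  (* After multiplication by the order [F] of the kernel, both sides are the
     sum of [v] over the class of [x] mod [d]. *)
  move=> xn; apply: (mulfI (lt0r_neq0 F0)); rewrite /w mulVKf ?lt0r_neq0 //.
  have px : periodic_mod n (fun z => (z == x %[mod d])%:R * v z).
    by move=> z; rewrite modn_dvdm // pv.
  rewrite -(sum_coprime_mul px xn) /F -(fiber_card pp d0 (coprime1n d)) mulr_suml.
  apply: eq_bigr => k kn /=.
  have -> : (x * k == x %[mod d])%N = (k == 1 %[mod d])%N.
    by rewrite -(@eqmod_mul2l d x k 1) ?(coprime_dvdr dn) // muln1.
  case: eqP => [k1|_]; last by rewrite !mul0r.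
  by rewrite mulnC vi.
have sumF g : periodic_mod d g ->
    \sum_(y < n | coprime y n) g y = F * \sum_(b < d | coprime b d) g b.
  move=> pg; under eq_bigr => y _ do rewrite -[g y]mul1r.
  rewrite (@sum_fibers n d (fun=> 1)) // mulr_sumr; apply: eq_bigr => b bd.
  under eq_bigr => y _ do rewrite mulr1.
  by rewrite fiber_card // mulrC.
have sqnF : sqnorm n v = F * sqnorm d w.
  rewrite /sqnorm -(sumF (fun b => w b ^+ 2)); last by move=> x; rewrite pw.
  by apply: eq_bigr => x xn; rewrite wE.
pose h := conv d (saw d) w.
have ph : periodic_mod d h by apply: conv_periodic.
pose eps : R := (~~ (p %| d)%N)%:R.
have convE x : coprime x n ->
    conv n (saw n) v x = p%:R * (h x - eps * h (p * x)%N).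
  move=> xn.
  transitivity (\sum_(a < n | coprime a n) saw n a * w (a * x)%N).
    by apply: eq_bigr => a an; rewrite wE // coprimeMl an.
  rewrite (@sum_fibers n d (saw n) (fun a => w (a * x)%N)) //; last first.
    by move=> a; apply: (eq_periodic_mod pw); rewrite modnMml.
  under eq_bigr => b bd do rewrite saw_fiber // mulrCA mulrBr.
  rewrite -mulr_sumr sumrB; congr (_ * (_ - _)).
    by apply: eq_bigr => b _; rewrite mulrC.
  under eq_bigr => b bd do rewrite mulrCA.
  rewrite -mulr_sumr /eps; case: (boolP (p %| d)%N) => pd; first by rewrite !mul0r.
  have cpd : coprime p d by rewrite prime_coprime.
  rewrite !mul1r.
  pose G t := saw d t * w (t * (p * x))%N.
  rewrite -[RHS](@sum_coprime_mul R d (inv_mod d p) G) ?coprime_inv_mod //; last first.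
    move=> t; rewrite /G saw_periodic; congr (_ * _).
    by apply: (eq_periodic_mod pw); rewrite modnMml.
  apply: eq_bigr => b _; rewrite /G mulrC; congr (_ * _); apply: (eq_periodic_mod pw).
  have -> : (inv_mod d p * b * (p * x) = (p * inv_mod d p) * (b * x))%N by ring.
  by rewrite -(modnMml (p * inv_mod d p)) inv_modP // modnMml mul1n.
pose g x := (p%:R * (h x - eps * h (p * x)%N)) ^+ 2.
have pg : periodic_mod d g.
  move=> x; rewrite /g ph; congr ((_ * (_ - _ * _)) ^+ 2).
  by apply: (eq_periodic_mod ph); rewrite modnMmr.
have -> : sqnorm n (conv n (saw n) v) = F * \sum_(b < d | coprime b d) g b.
  by rewrite -sumF //; apply: eq_bigr => x xn; rewrite convE.
rewrite sqnF [X in _ <= X]mulrCA ler_pM2l //.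
have {}HC := HC w pw; rewrite -/h in HC.
set e : R := if _ then _ else _.
have -> : e * p%:R ^+ 2 * C * sqnorm d w = p%:R ^+ 2 * (e * (C * sqnorm d w)) by ring.
have -> : \sum_(b < d | coprime b d) g b =
    p%:R ^+ 2 * \sum_(b < d | coprime b d) (h b - eps * h (p * b)%N) ^+ 2.
  by rewrite mulr_sumr; apply: eq_bigr => b _; rewrite /g exprMn.
apply: ler_wpM2l; first by rewrite exprn_ge0.
rewrite /eps /e; case: (boolP (p %| d)%N) => pd.
  rewrite mul1r; apply: le_trans HC; apply: ler_sum => b _.
  by rewrite mul0r subr0.
have cpd : coprime p d by rewrite prime_coprime.
have h2 : \sum_(b < d | coprime b d) h (p * b)%N ^+ 2 = sqnorm d h.
  rewrite (@sum_coprime_mul R d p (fun t => h t ^+ 2)) // => t; by rewrite ph.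
apply: le_trans (_ : \sum_(b < d | coprime b d) (2 * h b ^+ 2 + 2 * h (p * b)%N ^+ 2) <= _).
  by apply: ler_sum => b _; rewrite mul1r; have := sqr_ge0 (h b + h (p * b)%N); nra.
rewrite big_split /= -!mulr_sumr h2 -/(sqnorm d h); lra.
Qed.
End Descent.

(** * Fourier expansion of the sawtooth and the primitive part *)

Section Trig.
Variable R : realType.
Implicit Types (n t h x : nat).

Definition angle n t : R := pi *+ 2 * t%:R / n%:R.
Definition cos_mod n t : R := cos (angle n t).
Definition sin_mod n t : R := sin (angle n t).

Lemma angle_mod n t : angle n t =
  angle n (t %% n) + (pi *+ 2) *+ (if n == 0 then 0 else (t %/ n))%N.
Proof.
case: eqP => [->|/eqP n0]; first by rewrite modn0 mulr0n addr0.
rewrite {1}/angle {1}(divn_eq t n) natrD natrM /angle -[_ *+ (t %/ n)]mulr_natr.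
by field; rewrite pnatr_eq0.
Qed.

Lemma sin_mod_periodic n : periodic_mod n (sin_mod n).
Proof. by move=> t; rewrite /sin_mod (angle_mod n t) (periodicn (@sinD2pi R)). Qed.

Lemma cos_mod_periodic n : periodic_mod n (cos_mod n).
Proof. by move=> t; rewrite /cos_mod (angle_mod n t) (periodicn (@cosD2pi R)). Qed.

Lemma cos_mod_sub n a b : (b <= a)%N ->
  cos_mod n a * cos_mod n b + sin_mod n a * sin_mod n b = cos_mod n (a - b).
Proof. by move=> ba; rewrite -cosB /cos_mod /angle natrB // mulrBr mulrBl. Qed.

Lemma half_angle_bounds n h : (0 < h < n)%N -> 0 < (pi * h%:R / n%:R : R) < pi.
Proof.
move=> /andP[h0 hn]; have n0 : (0 : R) < n%:R by rewrite ltr0n (ltn_trans h0).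
have pi0 := pi_gt0 R; have hR : (0 : R) < h%:R by rewrite ltr0n.
rewrite divr_gt0 ?mulr_gt0 //=.
by rewrite ltr_pdivrMr // ltr_pM2l // ltr_nat.
Qed.

(** Multiplying by [2 sin b] makes the sum telescope. *)
Lemma dirichlet_kernel (b : R) m :
  2 * sin b * \sum_(x < m) cos (b * 2 * x%:R) = sin (b * 2 * m%:R - b) + sin b.
Proof.
elim: m => [|m IH]; first by rewrite big_ord0 !mulr0 sub0r sinN addNr.
rewrite big_ord_recr /= mulrDr IH.
have -> : b * 2 * m.+1%:R - b = b * 2 * m%:R + b by rewrite -natr1; ring.
by rewrite sinB sinD; ring.
Qed.

Lemma cos_mod_sum n t : (0 < n)%N ->
  \sum_(x < n) cos_mod n (t * x) = if (n %| t)%N then n%:R else 0.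
Proof.
move=> n0; have nR0 : n%:R != 0 :> R by rewrite pnatr_eq0 -lt0n.
case: ifPn => nt.
  rewrite -[RHS](_ : \sum_(x < n) 1 = n%:R); last by rewrite sumr_const card_ord.
  apply: eq_bigr => x _; rewrite -cos_mod_periodic -modnMml (eqP nt) mul0n mod0n.
  by rewrite /cos_mod /angle mulr0 mul0r cos0.
have r_lt : (0 < t %% n < n)%N by rewrite lt0n nt ltn_mod.
pose b : R := pi * (t %% n)%:R / n%:R.
have sb : sin b != 0 by apply: lt0r_neq0; apply: sin_gt0_pi; apply: half_angle_bounds.
have := dirichlet_kernel b n.
have -> : b * 2 * n%:R - b = - b + (pi *+ 2) *+ (t %% n).
  by rewrite -[_ *+ (t %% n)]mulr_natr /b; field.
rewrite (periodicn (@sinD2pi R)) sinN addNr => /eqP.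
rewrite !mulf_eq0 (negbTE sb) pnatr_eq0 /= => /eqP e.
rewrite -[RHS]e; apply: eq_bigr => x _; rewrite -cos_mod_periodic -modnMml cos_mod_periodic.
by rewrite /cos_mod /angle natrM; congr cos; rewrite /b; field.
Qed.

(** [h = 0] is harmless: there the division by [sin 0 = 0] yields 0. *)
Definition saw_coef n h : R := - (cos (pi * h%:R / n%:R) / sin (pi * h%:R / n%:R) / 2).

Lemma saw_coef0 n : saw_coef n 0 = 0.
Proof. by rewrite /saw_coef mulr0 mul0r sin0 invr0 mulr0 mul0r oppr0. Qed.

Lemma natr_modnS n x : (0 < n)%N ->
  ((x.+1 %% n)%:R : R) = (x %% n)%:R + 1 - (n %| x.+1)%N%:R * n%:R.
Proof.
move=> n0; rewrite modnS; case: ifPn => nx; last by rewrite mul0r subr0 -natr1.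
have lt : ((x %% n).+1 <= n)%N by rewrite ltn_mod.
have : (n %| (x %% n).+1)%N by rewrite /dvdn -addn1 modnDml addn1.
move/dvdn_leq => /(_ isT) le; have -> : n%:R = (x %% n).+1%:R :> R.
  by congr _%:R; apply/eqP; rewrite eqn_leq le.
by rewrite mul1r -natr1 subrr.
Qed.

(** Both sides vanish at 0 and have the same increments: the difference of sines
times the cotangent is a sum of two cosines, which [cos_mod_sum] evaluates. *)
Lemma saw_fourier n x : (0 < n)%N ->
  saw R n x = \sum_(h < n) saw_coef n h * sin_mod n (h * x).
Proof.
move=> n0; elim: x => [|x IH].
  rewrite /saw dvdn0 big1 // => h _.
  by rewrite muln0 /sin_mod /angle mulr0 mul0r sin0 mulr0.
have step : \sum_(h < n) saw_coef n h * sin_mod n (h * x.+1)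
     - \sum_(h < n) saw_coef n h * sin_mod n (h * x)
   = - (\sum_(h < n) (cos_mod n (x.+1 * h) + cos_mod n (x * h)) - 2) / 2.
  rewrite -sumrB; case: n n0 {IH} => // n _.
  rewrite !big_ord_recl /= !saw_coef0 !mul0r subrr add0r !muln0.
  have -> : cos_mod n.+1 0 = 1 by rewrite /cos_mod /angle mulr0 mul0r cos0.
  set A := \sum_(i < n) _; set B := \sum_(i < n) _.
  suff -> : A = - B / 2 by field.
  rewrite /A /B -sumrN mulr_suml; apply: eq_bigr => i _.
  have hn : (0 < bump 0 i < n.+1)%N by rewrite /bump leq0n add1n /= ltnS (valP i).
  set h := bump 0 i in hn *.
  set b : R := pi * h%:R / n.+1%:R.
  have sb : sin b != 0.
    by apply: lt0r_neq0; apply: sin_gt0_pi; apply: half_angle_bounds.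
  pose c : R := b * (2 * x%:R + 1).
  have -> : sin_mod n.+1 (h * x.+1) = sin (c + b).
    rewrite /sin_mod /angle /c /b; congr sin; rewrite natrM -natr1; field.
    by rewrite nat1r pnatr_eq0.
  have -> : sin_mod n.+1 (h * x) = sin (c - b).
    rewrite /sin_mod /angle /c /b; congr sin; rewrite natrM; field.
    by rewrite nat1r pnatr_eq0.
  have -> : cos_mod n.+1 (x.+1 * h) = cos (c + b).
    rewrite /cos_mod /angle /c /b; congr cos; rewrite natrM -natr1; field.
    by rewrite nat1r pnatr_eq0.
  have -> : cos_mod n.+1 (x * h) = cos (c - b).
    rewrite /cos_mod /angle /c /b; congr cos; rewrite natrM; field.
    by rewrite nat1r pnatr_eq0.
  rewrite /saw_coef -/b sinD sinB cosD cosB; field.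
  by rewrite sb.
move: step; rewrite big_split /= !cos_mod_sum // -IH => /eqP; rewrite subr_eq => /eqP ->.
rewrite !sawE // natr_modnS //.
by do 2 case: (n %| _)%N; rewrite /= ?mul1r ?mul0r; field.
Qed.

(** The real form of the orthogonality of the additive characters mod [n]. *)
Lemma sin_cos_mod_orth n h y z : (y < n)%N -> (z < n)%N -> coprime h n ->
  \sum_(x < n) (sin_mod n (h * (x * y)) * sin_mod n (h * (x * z))
              + cos_mod n (h * (x * y)) * cos_mod n (h * (x * z)))
  = if y == z then n%:R else 0.
Proof.
wlog le_zy : y z / (z <= y)%N.
  move=> H yn zn hn; case/orP: (leq_total z y) => le; first exact: H.
  rewrite eq_sym -(H z y) //; apply: eq_bigr => x _.
  by congr (_ + _); rewrite mulrC.
move=> yn zn hn; have n0 : (0 < n)%N by apply: leq_ltn_trans yn.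
rewrite (eq_bigr (fun x : 'I_n => cos_mod n (h * (y - z) * x))) => [|x _].
  rewrite cos_mod_sum // Gauss_dvdr 1?coprime_sym //.
  rewrite -eqn_mod_dvd // !modn_small //.
by rewrite addrC cos_mod_sub ?leq_mul // -!mulnBr -mulnA [(x * _)%N]mulnC.
Qed.

(** Adding the cosine sums and the non-reduced [x] only increases the left-hand
side, and the completed sum equals the right-hand side by orthogonality. *)
Lemma sin_mod_bound n h (u : nat -> R) : coprime h n ->
  \sum_(x < n | coprime x n) (\sum_(y < n | coprime y n) sin_mod n (h * (x * y)) * u y) ^+ 2
  <= n%:R * sqnorm n u.
Proof.
move=> hn.
apply: (@le_trans _ _ (\sum_(x < n) (
     (\sum_(y < n | coprime y n) sin_mod n (h * (x * y)) * u y) ^+ 2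
   + (\sum_(y < n | coprime y n) cos_mod n (h * (x * y)) * u y) ^+ 2))).
  rewrite big_mkcond /=; apply: ler_sum => x _; case: ifP => _.
    by rewrite lerDl sqr_ge0.
  by rewrite addr_ge0 // sqr_ge0.
under eq_bigr => x _.
  rewrite !expr2 !big_distrlr -big_split /=.
  under eq_bigr => y _ do rewrite -big_split /=.
over.
rewrite exchange_big /= /sqnorm mulr_sumr; apply: ler_sum => y yn.
rewrite exchange_big /=.
have inner (z : 'I_n) : \sum_(x < n)
     (sin_mod n (h * (x * y)) * u y * (sin_mod n (h * (x * z)) * u z) +
      cos_mod n (h * (x * y)) * u y * (cos_mod n (h * (x * z)) * u z)) =
    (if y == z then n%:R else 0) * (u y * u z).
  have := sin_cos_mod_orth (ltn_ord y) (ltn_ord z) hn.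
  rewrite -[(y : nat) == z]/(y == z) => <-.
  by rewrite mulr_suml; apply: eq_bigr => x _; ring.
under eq_bigr => z _ do rewrite inner.
rewrite (bigD1 y) //= eqxx big1 ?addr0 ?expr2 // => z /andP[_ zy].
by rewrite eq_sym (negbTE zy) mul0r.
Qed.

(** Expand both sides as double sums and use [2 |s i s j| <= s i ^ 2 + s j ^ 2]
termwise. *)
Lemma weighted_cauchy (I : finType) (b s : I -> R) :
  (\sum_i b i * s i) ^+ 2 <= (\sum_i `|b i|) * (\sum_i `|b i| * s i ^+ 2).
Proof.
rewrite -(@ler_pM2l _ 2) //.
have -> : 2 * ((\sum_i `|b i|) * (\sum_i `|b i| * s i ^+ 2)) =
   \sum_i \sum_j (`|b i| * `|b j|) * (s i ^+ 2 + s j ^+ 2).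
  under [RHS]eq_bigr => i _ do
    (under eq_bigr => j _ do rewrite mulrDr; rewrite big_split /=).
  rewrite big_split /= mulr_natl mulr2n big_distrlr /=; congr (_ + _).
    rewrite exchange_big /=; apply: eq_bigr => i _; apply: eq_bigr => j _; ring.
  by apply: eq_bigr => i _; apply: eq_bigr => j _; rewrite mulrA.
rewrite expr2 big_distrlr mulr_sumr; apply: ler_sum => i _.
rewrite mulr_sumr; apply: ler_sum => j _.
apply: le_trans (ler_norm _) _; rewrite !normrM ger0_norm //.
rewrite -[s i ^+ 2]real_normK ?num_real // -[s j ^+ 2]real_normK ?num_real //.
have -> : 2 * (`|b i| * `|s i| * (`|b j| * `|s j|)) =
  `|b i| * `|b j| * (2 * (`|s i| * `|s j|)) by ring.
apply: ler_wpM2l; first by rewrite mulr_ge0.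
by have := sqr_ge0 (`|s i| - `|s j|); nra.
Qed.

(** Replacing [x] by its inverse turns the convolution into the bilinear sum of
[saw n (x y) * u y], to which the Fourier expansion of the sawtooth applies.  If a
prime [p] divides [n] and [h], the sine of frequency [h] is invariant under the
kernel of reduction mod [n / p], hence orthogonal to [u]. *)
Lemma primitive_bound n (u : nat -> R) : (0 < n)%N -> periodic_mod n u ->
  (forall p x, prime p -> (p %| n)%N -> kernel_sum n (n %/ p) u x = 0) ->
  sqnorm n (conv n (saw R n) u) <= (\sum_(h < n) `|saw_coef n h|) ^+ 2 * n%:R * sqnorm n u.
Proof.
move=> n0 pu up; set B := \sum_(h < n) _.
pose S h x := \sum_(y < n | coprime y n) sin_mod n (h * (x * y)) * u y.
have S0 h x : coprime x n -> ~~ coprime h n -> S h x = 0.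
  move=> xn hn.
  have g1 : (1 < gcdn h n)%N.
    by rewrite ltn_neqAle gcdn_gt0 n0 orbT andbT eq_sym.
  have pp := pdiv_prime g1; set p := pdiv _ in pp.
  have /andP[ph pn] : (p %| h)%N && (p %| n)%N by rewrite -dvdn_gcd pdiv_dvd.
  apply: (@kernel_inv_orth R n (n %/ p) (fun y => sin_mod n (h * (x * y))) u) => //.
  - exact: dvdn_div.
  - move=> y; apply: (eq_periodic_mod (@sin_mod_periodic n)).
    by rewrite !mulnA modnMmr.
  - move=> k y kn k1; apply: (eq_periodic_mod (@sin_mod_periodic n)).
    have hk : h * k = h %[mod n].
      rewrite -(divnK pn) -(divnK ph) mulnAC -!muln_modl.
      by rewrite -modnMmr k1 modnMmr muln1.
    have -> : (h * (x * (k * y)) = h * k * (x * y))%N by ring.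
    by rewrite -modnMml hk modnMml.
  - by move=> z; apply: up.
have -> : sqnorm n (conv n (saw R n) u) =
    \sum_(x < n | coprime x n) (\sum_(h < n) saw_coef n h * S h x) ^+ 2.
  rewrite /sqnorm -(@sum_coprime_inv R n (fun x => conv n (saw R n) u x ^+ 2)); last first.
    by move=> x; rewrite (conv_periodic _ _ pu).
  apply: eq_bigr => x xn; congr (_ ^+ 2).
  have pF : periodic_mod n (fun a => saw R n a * u (a * inv_mod n x)%N).
    by move=> a; rewrite saw_periodic; congr (_ * _); apply: (eq_periodic_mod pu); rewrite modnMml.
  rewrite /conv -(sum_coprime_mul pF xn).
  under [RHS]eq_bigr => h _ do rewrite mulr_sumr.
  rewrite exchange_big /=; apply: eq_bigr => b bn.
  have -> : u (x * b * inv_mod n x)%N = u b.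
    apply: (eq_periodic_mod pu); have -> : (x * b * inv_mod n x = x * inv_mod n x * b)%N by ring.
    by rewrite -modnMml inv_modP // modnMml mul1n.
  by rewrite saw_fourier // mulr_suml; apply: eq_bigr => h _; rewrite mulrA.
apply: (@le_trans _ _ (\sum_(x < n | coprime x n)
     B * \sum_(h < n) `|saw_coef n h| * S h x ^+ 2)).
  by apply: ler_sum => x _; apply: weighted_cauchy.
have B0 : 0 <= B by apply: sumr_ge0 => h _.
rewrite -mulr_sumr expr2 -!mulrA; apply: ler_wpM2l => //.
rewrite exchange_big /= mulr_suml; apply: ler_sum => h _.
rewrite -mulr_sumr; apply: ler_wpM2l => //.
case: (boolP (coprime h n)) => hn; first exact: sin_mod_bound.
rewrite big1 ?mulr_ge0 ?sqnorm_ge0 // => x xn.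
by rewrite S0 // expr0n.
Qed.

Lemma mul_cos_le_sin (b : R) : 0 <= b -> b <= pi / 2 -> b * cos b <= sin b.
Proof.
move=> b0 b1; pose f (x : R) : R := sin x - x * cos x.
have df (x : R) : is_derive x 1 f (x * sin x).
  rewrite /f; apply: is_derive_eq.
  by rewrite /GRing.scale /=; ring.
have cf : {within `[0 : R, pi / 2], continuous f}%classic.
  apply: continuous_subspaceT => x.
  by apply/differentiable_continuous/derivable1_diffP; apply: ex_derive; exact: df.
have := @ger0_derive1_ndecr R f 0 (pi / 2) _ _ cf 0 b (lexx _) b0 b1.
rewrite /f sin0 mul0r subrr subr_ge0; apply.
  by move=> x _; apply: ex_derive; exact: df.
move=> x; rewrite in_itv /= => /andP[x0 x1].
rewrite derive1E (@derive_val _ _ _ _ _ _ _ (df x)) mulr_ge0 ?(ltW x0) //.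
by apply: sin_ge0_pi; rewrite (ltW x0) /=; have := pi_gt0 R; lra.
Qed.

Lemma cot_half_le n h : (0 < h)%N -> (h.*2 <= n)%N ->
  cos (pi * h%:R / n%:R) / sin (pi * h%:R / n%:R) <= n%:R / (2 * h%:R) :> R.
Proof.
move=> h0 hn; have pi2 := pi_ge2 R.
have n0 : (0 : R) < n%:R by rewrite ltr0n; lia.
have hR : (0 : R) < h%:R by rewrite ltr0n.
have hn' : 2 * h%:R <= n%:R :> R by rewrite -natrM ler_nat; lia.
set b : R := pi * h%:R / n%:R.
have /andP[b0 bpi] : 0 < b < pi by apply: half_angle_bounds; lia.
have b1 : b <= pi / 2.
  by rewrite /b ler_pdivrMr // mulrAC ler_pdivlMr //; nra.
have c := mul_cos_le_sin (ltW b0) b1.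
have s0 : 0 < sin b by apply: sin_gt0_pi; rewrite b0.
apply: (@le_trans _ _ b^-1).
  by rewrite ler_pdivrMr // mulrC ler_pdivlMr // mulrC.
rewrite /b invf_div; rewrite ler_pM2l // lef_pV2 ?posrE ?mulr_gt0 ?pi_gt0 //.
by rewrite ler_pM2r.
Qed.

(** The bound [cot b <= 1 / b], together with [pi >= 2], handles [h <= n / 2]; the
reflection [h |-> n - h] handles the other half.  Keeping both reciprocals for
all [h] avoids splitting the sum over [h]. *)
Lemma saw_coef_bound n h : (0 < h < n)%N ->
  `|saw_coef n h| <= n%:R / 4 * (h%:R^-1 + (n - h)%:R^-1).
Proof.
wlog hn2 : h / (h.*2 <= n)%N.
  move=> H hn; case: (leqP h.*2 n) => le; first exact: H.
  have hn' : (0 < n - h < n)%N by lia.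
  have le2 : ((n - h).*2 <= n)%N by lia.
  have lehn : (h <= n)%N by lia.
  have := H _ le2 hn'; rewrite subKn // addrC.
  suff -> : `|saw_coef n (n - h)| = `|saw_coef n h| by [].
  rewrite /saw_coef natrB //.
  have -> : pi * (n%:R - h%:R) / n%:R = pi - pi * h%:R / n%:R :> R.
    by field; rewrite pnatr_eq0; lia.
  rewrite cosB sinB sinpi cospi !mul0r addr0 sub0r !mulN1r opprK.
  by rewrite !mulNr !normrN.
move=> hn; have /andP[h0 hn'] := hn.
have n0 : (0 : R) < n%:R by rewrite ltr0n; lia.
have hR : (0 : R) < h%:R by rewrite ltr0n.
have /andP[b0 bpi] := half_angle_bounds hn.
have s0 : 0 < sin (pi * h%:R / n%:R : R) by apply: sin_gt0_pi; rewrite b0.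
have c0 : 0 <= cos (pi * h%:R / n%:R : R).
  apply: cos_ge0_pihalf; apply/andP; split; first by have := pi_gt0 R; lra.
  rewrite ler_pdivrMr // mulrAC ler_pdivlMr //.
  have : 2 * h%:R <= n%:R :> R by rewrite -natrM ler_nat; lia.
  by have := pi_gt0 R; nra.
rewrite /saw_coef normrN ger0_norm ?divr_ge0 ?(ltW s0) //.
apply: (@le_trans _ _ (n%:R / (2 * h%:R) / 2)).
  by rewrite ler_pM2r ?invr_gt0 //; apply: cot_half_le.
rewrite [X in X <= _](_ : _ = n%:R / 4 * h%:R^-1); last by field; lra.
by rewrite ler_pM2l ?divr_gt0 // lerDl invr_ge0 ler0n.
Qed.

(** The increment is handled by [ln (1 - 1/(n+1)) <= - 1/(n+1)] and
[1/n <= 3/(n+1)]. *)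
Lemma harmonic_le_ln n : (0 < n)%N -> \sum_(1 <= h < n) (h%:R^-1 : R) <= 3 * ln n%:R.
Proof.
elim: n => // -[|n] IH _; first by rewrite big_geq // ln1 mulr0.
rewrite big_nat_recr //=; have := IH isT; set m := n.+1.
have m0 : (0 : R) < m%:R by rewrite ltr0n.
have m1 : (0 : R) < m.+1%:R by rewrite ltr0n.
have e : m%:R = m.+1%:R * (1 - m.+1%:R^-1) :> R.
  by rewrite mulrBr mulr1 divff ?lt0r_neq0 // -natr1 addrK.
have i1 : m.+1%:R^-1 < 1 :> R by rewrite invf_lt1 // ltr1n.
have := @le_ln1Dx R (- m.+1%:R^-1); rewrite ltrN2 i1 => /(_ isT) l.
have -> : ln m%:R = ln m.+1%:R + ln (1 - m.+1%:R^-1) :> R.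
  by rewrite [m%:R in LHS]e lnM ?posrE ?subr_gt0.
have : m%:R^-1 <= 3 * m.+1%:R^-1 :> R.
  rewrite ler_pdivlMr // mulrC ler_pdivrMr // -natr1.
  have : (1 : R) <= m%:R by rewrite ler1n.
  lra.
have lin (S J L a i : R) : a <= - i -> J <= 3 * i -> S <= 3 * (L + a) -> S + J <= 3 * L.
  by move=> *; lra.
exact: lin l.
Qed.

Lemma saw_coef_sum n : (0 < n)%N ->
  \sum_(h < n) `|saw_coef n h| <= 3 / 2 * n%:R * ln n%:R.
Proof.
move=> n0; have nR : (0 : R) < n%:R by rewrite ltr0n.
rewrite -(big_mkord xpredT (fun h => `|saw_coef n h|)) big_ltn // saw_coef0 normr0 add0r.
apply: (@le_trans _ _ (\sum_(1 <= h < n) n%:R / 4 * (h%:R^-1 + (n - h)%:R^-1))).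
  by apply: ler_sum_nat => h; apply: saw_coef_bound.
have rev : \sum_(1 <= h < n) (n - h)%:R^-1 = \sum_(1 <= h < n) (h%:R^-1 : R).
  rewrite big_nat_rev /=; apply: eq_big_nat => h /andP[h1 hn]; congr (_%:R^-1); lia.
rewrite -mulr_sumr big_split /= rev.
have := harmonic_le_ln n0; nra.
Qed.
End Trig.

(** * The operator norm and the sums over tuples *)

Section Final.
Variable R : realType.
Implicit Types (n d p k x : nat).

(** Descending from [2 d] to an odd [d] costs [4 * 2^2 / 2^3 = 2] in the bound
for the squared norm, and descending from [3 d] to a [d] prime to 3 costs
[4 * 3^2 / 3^3 < 2]; every other descent is free.  The power of 2 pays for these
two steps, and its largest value 4 gives the constant [12 = (2 sqrt 3)^2]. *)
Definition norm_bound n : R :=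
  3 * 2 ^+ ((2 %| n) + (3 %| n))%N * n%:R ^+ 3 * ln n%:R ^+ 2.

Lemma norm_bound_descent p d : prime p -> (0 < d)%N ->
  (if (p %| d)%N then 1 else 4) * p%:R ^+ 2 * norm_bound d <= norm_bound (p * d).
Proof.
move=> pp d0; have p2 := prime_gt1 pp.
have d1 : (1 : R) <= d%:R by rewrite ler1n.
have pR : (2 : R) <= p%:R by rewrite ler_nat.
have ln_le : ln (d%:R : R) ^+ 2 <= ln (p * d)%:R ^+ 2.
  apply: lerXn2r; rewrite ?nnegrE ?ln_ge0 // ?ler1n ?muln_gt0 ?d0 ?prime_gt0 //.
  by rewrite ler_ln ?posrE ?ltr0n ?muln_gt0 ?d0 ?prime_gt0 // ler_nat leq_pmull ?prime_gt0.
suff loss : (if (p %| d)%N then 1 else 4) * 2 ^+ ((2 %| d) + (3 %| d))%N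
     <= p%:R * 2 ^+ ((2 %| p * d) + (3 %| p * d))%N :> R.
  rewrite /norm_bound natrM exprMn.
  have -> : (if (p %| d)%N then 1 else 4) * p%:R ^+ 2 *
     (3 * 2 ^+ ((2 %| d) + (3 %| d))%N * d%:R ^+ 3 * ln d%:R ^+ 2) =
     ((if (p %| d)%N then 1 else 4) * 2 ^+ ((2 %| d) + (3 %| d))%N) *
     (3 * p%:R ^+ 2 * d%:R ^+ 3) * ln d%:R ^+ 2 :> R by ring.
  rewrite [X in _ <= X](_ : _ = (p%:R * 2 ^+ ((2 %| p * d) + (3 %| p * d))%N) *
     (3 * p%:R ^+ 2 * d%:R ^+ 3) * ln (p%:R * d%:R) ^+ 2); last by ring.
  rewrite -natrM; apply: ler_pM => //; last by apply: ler_wpM2r.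
    by rewrite !mulr_ge0 ?exprn_ge0 //; case: ifP.
  by rewrite sqr_ge0.
have expm (e f : nat) : (e <= f)%N -> 2 ^+ e <= 2 ^+ f :> R.
  by move=> ef; rewrite ler_eXn2l // ltr1n.
have mono : ((2 %| d) + (3 %| d) <= (2 %| p * d) + (3 %| p * d))%N.
  by apply: leq_add; case: (boolP (_ %| d)%N) => // h; rewrite dvdn_mull.
case: (boolP (p %| d)%N) => pd.
  by rewrite ler_pM ?exprn_ge0 ?expm //; lra.
case: (ltnP 3 p) => p3.
  rewrite ler_pM ?exprn_ge0 ?expm //.
  by rewrite ler_nat.
have lt : ((2 %| d) + (3 %| d) < (2 %| p * d) + (3 %| p * d))%N.
  have [e|e] : p = 2 \/ p = 3 by lia.
    move: pd; rewrite e => /negbTE ->; rewrite dvdn_mulr // add0n add1n ltnS.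
    by case: (boolP (3 %| d)%N) => // h; rewrite dvdn_mull.
  move: pd; rewrite e => /negbTE ->; rewrite (dvdn_mulr d (dvdnn 3)) addn0 addn1 ltnS.
  by case: (boolP (2 %| d)%N) => // h; rewrite dvdn_mull.
apply: (@le_trans _ _ (2 * 2 ^+ ((2 %| d) + (3 %| d)).+1)).
  by rewrite exprS; lra.
by rewrite ler_pM ?exprn_ge0 ?expm.
Qed.

(** Induction on [n]: the averages reduce to the proper divisors [n / p], the
remainder is the primitive part. *)
Lemma conv_saw_bound n (u : nat -> R) : (0 < n)%N -> periodic_mod n u ->
  sqnorm n (conv n (saw R n) u) <= norm_bound n * sqnorm n u.
Proof.
elim/ltn_ind: n u => n IH u n0.
apply: (@conv_bound_split R n (saw R n) (norm_bound n)
  [seq (n %/ p)%N | p <- primes n]) => //.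
- move=> d /mapP[p]; rewrite mem_primes => /and3P[_ _ pn] ->; exact: dvdn_div.
- move=> d v /mapP[p]; rewrite mem_primes => /and3P[pp _ pn] {d}-> pv vi.
  have d0 : (0 < n %/ p)%N by rewrite divn_gt0 ?prime_gt0 // dvdn_leq.
  have dn : (n %/ p < n)%N by rewrite ltn_Pdiv ?prime_gt1.
  have nE : (p * (n %/ p))%N = n by rewrite mulnC divnK.
  have := conv_descent pp d0 (fun w pw => IH _ dn w d0 pw); rewrite nE.
  move=> /(_ v pv vi) le; apply: le_trans le _; apply: ler_wpM2r; first exact: sqnorm_ge0.
  by have := norm_bound_descent pp d0; rewrite nE.
move=> w pw w0; apply: le_trans (primitive_bound n0 pw _) _.
  by move=> p x pp pn; apply: w0; apply: map_f; rewrite mem_primes pp n0.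
apply: ler_wpM2r; first exact: sqnorm_ge0.
have L0 : 0 <= ln n%:R :> R by rewrite ln_ge0 // ler1n.
have B0 : 0 <= \sum_(h < n) `|saw_coef R n h| by apply: sumr_ge0.
apply: (@le_trans _ _ ((3 / 2 * n%:R * ln n%:R) ^+ 2 * n%:R)).
  apply: ler_wpM2r => //; apply: lerXn2r; rewrite ?nnegrE ?mulr_ge0 //; last exact: saw_coef_sum.
rewrite /norm_bound [X in X <= _](_ : _ = 9 / 4 * (n%:R ^+ 3 * ln n%:R ^+ 2)); last by field.
rewrite -[X in _ <= X]mulrA; apply: ler_wpM2r; first by rewrite mulr_ge0 ?exprn_ge0.
have : 1 <= 2 ^+ ((2 %| n) + (3 %| n))%N :> R by rewrite exprn_ege1 // ler1n.
by move: (2 ^+ _) => z *; lra.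
Qed.

Lemma norm_bound_le n : (0 < n)%N -> norm_bound n <= 12 * n%:R ^+ 3 * ln n%:R ^+ 2.
Proof.
move=> n0; apply: ler_wpM2r; first by rewrite sqr_ge0.
apply: ler_wpM2r; first by rewrite exprn_ge0.
have : 2 ^+ ((2 %| n) + (3 %| n))%N <= 2 ^+ 2 :> R.
  by rewrite ler_eXn2l ?ltr1n //; do 2 case: (_ %| _)%N.
by rewrite expr2; move: (2 ^+ _) => z *; lra.
Qed.

Lemma iter_periodic n f k (phi : nat -> R) : periodic_mod n phi ->
  periodic_mod n (iter k (conv n f) phi).
Proof. by move=> pp; elim: k => // k IH; apply: conv_periodic. Qed.

Lemma iter_saw_bound n k (phi : nat -> R) : (0 < n)%N -> periodic_mod n phi ->
  sqnorm n (iter k (conv n (saw R n)) phi) <=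
  (12 * n%:R ^+ 3 * ln n%:R ^+ 2) ^+ k * sqnorm n phi.
Proof.
move=> n0 pp; elim: k => [|k IH]; first by rewrite mul1r.
rewrite iterS exprS -mulrA.
apply: le_trans (conv_saw_bound n0 (iter_periodic _ k pp)) _.
apply: le_trans (ler_wpM2r (sqnorm_ge0 _ _) (norm_bound_le n0)) _.
by apply: ler_wpM2l IH; rewrite !mulr_ge0 ?exprn_ge0 // ln_ge0 // ler1n.
Qed.

Lemma sum_coprime1 n : \sum_(a < n | coprime a n) (1 : R) = (totient n)%:R.
Proof.
rewrite totient_count_coprime big_mkord natr_sum big_mkcond /=.
by apply: eq_bigr => i _; rewrite coprime_sym; case: coprime.
Qed.

Lemma sum_coprime_mulr n (phi : nat -> R) x : periodic_mod n phi -> coprime x n ->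
  \sum_(a < n | coprime a n) phi (a * x)%N = \sum_(a < n | coprime a n) phi a.
Proof.
by move=> pp xn; rewrite -[RHS](sum_coprime_mul pp xn); apply: eq_bigr => a _; rewrite mulnC.
Qed.

Lemma sum_coprime_conv n f (phi : nat -> R) : periodic_mod n phi ->
  \sum_(x < n | coprime x n) conv n f phi x =
  (\sum_(a < n | coprime a n) f a) * \sum_(x < n | coprime x n) phi x.
Proof.
move=> pp; rewrite exchange_big mulr_suml; apply: eq_bigr => a an.
by rewrite -mulr_sumr sum_coprime_mul.
Qed.

(** The mixed terms contain the sum of [saw] over the reduced residues, which is
zero. *)
Lemma iter_conv_split_mean n k (phi : nat -> R) x :
  (2 <= n)%N -> periodic_mod n phi -> coprime x n ->
  iter k.+1 (conv n (fun a => a%:R)) phi x =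
  (n%:R / 2) ^+ k.+1 * (totient n)%:R ^+ k * \sum_(a < n | coprime a n) phi a
  + iter k.+1 (conv n (saw R n)) phi x.
Proof.
move=> n2 pp; have fE (a : 'I_n) : coprime a n -> a%:R = n%:R / 2 + saw R n a.
  move=> an; rewrite /saw modn_small //; case: ifPn => [na|_]; last by rewrite addrC subrK.
  by move: an; rewrite coprime_sym /coprime (gcdn_idPl na); lia.
set S := \sum_(a < n | _) _; set c : R := n%:R / 2; set t : R := (totient n)%:R.
elim: k x => [|k IH] x xn.
  rewrite /= expr1 expr0 mulr1 /S -(sum_coprime_mulr pp xn) mulr_sumr -big_split.
  by apply: eq_bigr => a an; rewrite fE // mulrDl.
rewrite iterS [in RHS]iterS.
set psi := iter k.+1 (conv n (saw R n)) phi.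
have pps : periodic_mod n psi by apply: iter_periodic.
transitivity (\sum_(a < n | coprime a n)
  ((c + saw R n a) * (c ^+ k.+1 * t ^+ k * S + psi (a * x)%N))).
  by apply: eq_bigr => a an; rewrite fE // IH // coprimeMl an.
(* Grouped so that the second and third sums vanish and the fourth is the next
   iterate. *)
transitivity (\sum_(a < n | coprime a n) (c ^+ k.+2 * t ^+ k * S * 1 + c * psi (a * x)%N
   + (c ^+ k.+1 * t ^+ k * S * saw R n a + saw R n a * psi (a * x)%N))).
  by apply: eq_bigr => a _; rewrite [c ^+ k.+2]exprS; ring.
rewrite !big_split /= -!mulr_sumr sum_coprime1 saw_sum0 mulr0 add0r sum_coprime_mulr //.
rewrite /psi iterS sum_coprime_conv ?saw_sum0 ?mul0r ?mulr0 ?addr0; last exact: iter_periodic.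
by rewrite -/t [t ^+ k.+1]exprS; congr (_ + _); ring.
Qed.

Lemma sum_ffun_cons (T : finType) k (P : pred T) (F : {ffun 'I_k.+1 -> T} -> R) :
  \sum_(a : {ffun 'I_k.+1 -> T} | [forall j, P (a j)]) F a =
  \sum_(t | P t) \sum_(b : {ffun 'I_k -> T} | [forall j, P (b j)])
     F [ffun i => if unlift ord0 i is Some j then b j else t].
Proof.
pose cons (tb : T * {ffun 'I_k -> T}) : {ffun 'I_k.+1 -> T} :=
  [ffun i => if unlift ord0 i is Some j then tb.2 j else tb.1].
pose uncons (a : {ffun 'I_k.+1 -> T}) := (a ord0, [ffun j => a (lift ord0 j)]).
have consK : cancel cons uncons.
  move=> [t b]; congr pair; first by rewrite ffunE unlift_none.
  by apply/ffunP => j; rewrite !ffunE liftK.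
have unconsK : cancel uncons cons.
  move=> a; apply/ffunP => i; rewrite ffunE /=.
  by case: unliftP => [j|] ->; rewrite ?ffunE.
rewrite pair_big (reindex cons) /=; last by exists uncons => ? _.
apply: eq_bigl => -[t b] /=; apply/forallP/andP => [H|[Pt /forallP Pb] i].
  split; first by have := H ord0; rewrite ffunE unlift_none.
  by apply/forallP => j; have := H (lift ord0 j); rewrite ffunE liftK.
by rewrite ffunE /=; case: unliftP.
Qed.

(** Peeling off the first entry of a tuple matches one application of the operator:
the entry multiplies the argument [x]. *)
Lemma iter_conv_ffun n k (phi : nat -> R) x : (2 <= n)%N ->
  iter k (conv n (fun a => a%:R)) phi x =
  \sum_(a : {ffun 'I_k -> 'I_n.+1} | [forall j, (1 <= a j)%N && coprime (a j) n])
     (\prod_j a j)%N%:R * phi ((\prod_j a j) * x)%N.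
Proof.
move=> n2; elim: k x => [|k IH] x.
  rewrite (big_pred1 [ffun i : 'I_0 => ord0 : 'I_n.+1]) => [|a].
    by rewrite !big_ord0 mul1r mul1n.
  rewrite /=; have -> : a == [ffun i : 'I_0 => ord0 : 'I_n.+1] by apply/eqP/ffunP => -[].
  by apply/forallP => -[].
rewrite iterS (@sum_ffun_cons _ k (fun t : 'I_n.+1 => (1 <= t)%N && coprime t n)
  (fun a => (\prod_j a j)%N%:R * phi ((\prod_j a j) * x)%N)) /conv.
(* The value [n] is not coprime to [n], so the entries range over ['I_n]. *)
rewrite [RHS]big_mkcond big_ord_recr /= [coprime n n]/coprime gcdnn.
have -> : (n == 1)%N = false by lia.
rewrite andbF addr0 big_mkcond /=; apply: eq_bigr => a _.
have -> : ((0 < a) && coprime a n)%N = coprime a n.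
  case: (posnP a) => // ->; rewrite /coprime gcd0n; lia.
case: ifP => // an; rewrite IH mulr_sumr; apply: eq_bigr => b _.
set c := finfun _.
have -> : (\prod_j c j = a * \prod_j b j)%N.
  rewrite big_ord_recl /c ffunE unlift_none; congr (_ * _)%N.
  by apply: eq_bigr => j _; rewrite ffunE liftK.
by rewrite natrM mulrA mulnA [(_ * a)%N]mulnC.
Qed.
End Final.

Theorem theorem1 (R : realType) (k : nat) (hk : (3 <= k)%N)
    (n m : nat) (hn : (2 <= n)%N) (hm : (1 <= m)%N) (hmn : coprime m n) :
  `| (Sk k n m)%:R - 2 ^- k * n%:R ^+ k * (totient n)%:R ^+ (k - 1) |
    <= (2 * Num.sqrt 3) ^+ k * n%:R `^ ((3 * k)%:R / 2) * ln n%:R ^+ k :> R.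
Proof.
have n0 : (0 < n)%N by apply: ltnW.
pose phi x : R := (x == m %[mod n])%:R.
have pphi : periodic_mod n phi by move=> x; rewrite /phi modn_mod.
pose o : 'I_n := Ordinal (ltn_pmod m n0).
have phiE (x : 'I_n) : phi x = (x == o)%:R.
  by rewrite /phi modn_small //.
have co : coprime o n by rewrite coprime_modl.
have phi1 : \sum_(x < n | coprime x n) phi x = 1.
  rewrite (bigD1 o) // phiE eqxx big1 ?[LHS]addr0 // => x /andP[_ xo].
  by rewrite phiE (negbTE xo).
have sq1 : sqnorm n phi = 1.
  by rewrite -phi1; apply: eq_bigr => x _; rewrite phiE; case: eqP; rewrite ?expr1n ?expr0n.
have SkE : (Sk k n m)%:R = iter k (conv n (fun a => a%:R)) phi 1.
  rewrite iter_conv_ffun // /Sk natr_sum big_mkcondr /=.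
  apply: eq_bigr => a _; rewrite muln1 /phi; case: eqP; rewrite ?mulr1 ?mulr0 //.
set psi := iter k (conv n (saw R n)) phi.
have -> : (Sk k n m)%:R - 2 ^- k * n%:R ^+ k * (totient n)%:R ^+ (k - 1) = psi 1%N.
  rewrite SkE /psi; case: k hk {SkE psi} => // k _.
  rewrite iter_conv_split_mean ?coprime1n // phi1 mulr1 subn1 /= expr_div_n.
  by rewrite [2 ^- _ * _]mulrC addrAC subrr add0r.
have psi_le : psi 1%N ^+ 2 <= (12 * n%:R ^+ 3 * ln n%:R ^+ 2) ^+ k.
  (* [psi 1] is one of the terms of the squared norm of [psi]. *)
  have := iter_saw_bound k n0 pphi; rewrite sq1 mulr1; apply: le_trans.
  pose i : 'I_n := Ordinal hn.
  rewrite /sqnorm (bigD1 i) ?coprime1n //= lerDl; apply: sumr_ge0 => x _; exact: sqr_ge0.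
have L0 : 0 <= ln n%:R :> R by rewrite ln_ge0 // ler1n.
rewrite -(@ler_sqr R) ?nnegrE ?mulr_ge0 ?exprn_ge0 ?powR_ge0 ?sqrtr_ge0 //.
rewrite real_normK ?num_real //; apply: le_trans psi_le _.
rewrite le_eqVlt; apply/orP; left; apply/eqP.
have npow : (n%:R `^ ((3 * k)%:R / 2)) ^+ 2 = (n%:R ^+ 3) ^+ k :> R.
  by rewrite -powR_mulrn ?powR_ge0 // -powRrM divfK ?pnatr_eq0 // powR_mulrn // exprM.
have cpow : (2 * Num.sqrt 3) ^+ 2 = 12 :> R by rewrite exprMn sqr_sqrtr //; ring.
by rewrite 2![in RHS]exprMn npow !(exprAC _ k 2) cpow -!exprMn.
Qed.
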